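(* There exists a smooth function $u:\mathbb{C}^2\to\mathbb{R}$ that depends on only three of the four real coordinates $(\operatorname{Re}z_1,\operatorname{Im}z_1,\operatorname{Re}z_2,\operatorname{Im}z_2)$ and satisfies the complex Monge–Ampère equation $$\det\left(\frac{\partial^2u}{\partial z_i\,\partial\bar z_j}\right)_{i,j=1,2}=1\quad\text{on }\mathbb{C}^2,$$ and which is nonflat: the matrix $g_{i\bar j}=\partial^2u/\partial z_i\partial\bar z_j$ is positive definite at every point and the Kähler metric on $\mathbb{C}^2$ that it defines is not flat.
   Context: Coordinates on $\mathbb{C}^2$ are $(z_1,z_2)$. A Kähler metric is flat if its Riemann curvature tensor vanishes identically. *)

(* Defs.v *)
(* Calculus on Stdlib's R with Coquelicot; matrices, finite index types and
   iterated operators from MathComp (Rstruct makes R a MathComp field). *)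
From Stdlib Require Import Reals.
From mathcomp Require Import all_boot all_algebra.
From mathcomp Require Import Rstruct.
From Coquelicot Require Import Coquelicot.

Set Implicit Arguments.
Unset Strict Implicit.
Unset Printing Implicit Defensive.

Local Open Scope R_scope.

Definition C2 : Type := (C * C)%type.

Definition component (v : C2) (i : 'I_2) : C := if i == ord0 then v.1 else v.2.

(* The vector of C^2 whose i-th complex coordinate is c, the other being 0. *)
Definition axis (i : 'I_2) (c : C) : C2 :=
  if i == ord0 then (c, RtoC 0) else (RtoC 0, c).

(* The real basis of C^2 dual to (Re z1, Im z1, Re z2, Im z2). *)
Definition frame (a : 'I_4) : C2 :=
  match val a with
  | 0%nat => axis ord0 (RtoC 1)
  | 1%nat => axis ord0 Ci
  | 2%nat => axis ord_max (RtoC 1)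
  | _ => axis ord_max Ci
  end.

Definition translate (z v : C2) (h : R) : C2 :=
  ((z.1 + RtoC h * v.1)%C, (z.2 + RtoC h * v.2)%C).

Definition dir_derive (v : C2) (f : C2 -> R) (z : C2) : R :=
  Derive (fun h => f (translate z v h)) 0.

Definition ex_dir_derive (v : C2) (f : C2 -> R) (z : C2) : Prop :=
  ex_derive (fun h => f (translate z v h)) 0.

Definition partial (a : 'I_4) : (C2 -> R) -> C2 -> R := dir_derive (frame a).

(* Class C^n in the real sense: all iterated partial derivatives of order at
   most n with respect to the four real coordinates exist and are continuous. *)
Fixpoint of_class (n : nat) (f : C2 -> R) : Prop :=
  (forall z, continuous f z) /\
  match n with
  | O => True
  | S m => forall a : 'I_4,
      (forall z, ex_dir_derive (frame a) f z) /\ of_class m (partial a f)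
  end.

Definition smooth (f : C2 -> R) : Prop := forall n, of_class n f.

Definition independent_of_coord (a : 'I_4) (f : C2 -> R) : Prop :=
  forall z h, f (translate z (frame a) h) = f z.

Definition dir_deriveC (v : C2) (f : C2 -> C) (z : C2) : C :=
  (dir_derive v (fun w => Re (f w)) z, dir_derive v (fun w => Im (f w)) z).

(* Wirtinger operators d/dz_i and d/d(conj z_i). *)
Definition d_z (i : 'I_2) (f : C2 -> C) (z : C2) : C :=
  (RtoC (/ 2) * (dir_deriveC (axis i (RtoC 1)) f z
                 - Ci * dir_deriveC (axis i Ci) f z))%C.

Definition d_zbar (i : 'I_2) (f : C2 -> C) (z : C2) : C :=
  (RtoC (/ 2) * (dir_deriveC (axis i (RtoC 1)) f z
                 + Ci * dir_deriveC (axis i Ci) f z))%C.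

Definition complex_hessian (u : C2 -> R) (z : C2) : 'M[C]_2 :=
  \matrix_(i, j) d_z i (d_zbar j (fun w => RtoC (u w))) z.

(* Coquelicot's C carries no MathComp ring structure, hence no [\det]. *)
Definition det2 (A : 'M[C]_2) : C :=
  (A ord0 ord0 * A ord_max ord_max - A ord0 ord_max * A ord_max ord0)%C.

Definition sesq (A : 'M[C]_2) (v w : C2) : C :=
  \big[Cplus/RtoC 0]_(i < 2) \big[Cplus/RtoC 0]_(j < 2)
    (A i j * component v i * Cconj (component w j))%C.

(* The condition on the imaginary part for all v says that A is Hermitian. *)
Definition positive_definite (A : 'M[C]_2) : Prop :=
  forall v : C2, v <> (RtoC 0, RtoC 0) ->
    Im (sesq A v v) = 0 /\ 0 < Re (sesq A v v).

(* The Riemannian metric 2 Re (sum_ij g_(i jbar) dz_i (x) dzbar_j) underlying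
   the Kaehler metric with coefficients g, in the real coordinate frame; the
   normalisation is the one for which g_(i jbar) is the value of the complex
   bilinear extension on (d/dz_i, d/dzbar_j). *)
Definition riemannian_metric (g : C2 -> 'M[C]_2) (z : C2) : 'M[R]_4 :=
  \matrix_(a, b) (2 * Re (sesq (g z) (frame a) (frame b))).

(* Christoffel symbol G^k_(ij) of the Levi-Civita connection. *)
Definition christoffel (G : C2 -> 'M[R]_4) (k i j : 'I_4) (z : C2) : R :=
  / 2 * \big[Rplus/0]_(m < 4)
    (invmx (G z) k m *
       (partial i (fun w => G w j m) z + partial j (fun w => G w i m) z
        - partial m (fun w => G w i j) z)).

(* R^l_(kij): the l-th component of R(d_i, d_j) d_k, where
   R(X, Y) = [nabla_X, nabla_Y] - nabla_[X, Y]. *)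
Definition riemann_tensor (G : C2 -> 'M[R]_4) (l k i j : 'I_4) (z : C2) : R :=
  partial i (christoffel G l j k) z - partial j (christoffel G l i k) z
  + \big[Rplus/0]_(m < 4)
      (christoffel G l i m z * christoffel G m j k z
       - christoffel G l j m z * christoffel G m i k z).

Definition flat_kahler (g : C2 -> 'M[C]_2) : Prop :=
  forall (z : C2) (l k i j : 'I_4),
    riemann_tensor (riemannian_metric g) l k i j z = 0.

(* Main.v *)
Require Import Defs.
From Stdlib Require Import Reals Lra FunctionalExtensionality.
From mathcomp Require Import all_boot all_algebra.
From mathcomp Require Import Rstruct.
From Coquelicot Require Import Coquelicot.

(** The solution is the Kaehler potential of the Taub-NUT metric, pulled back to
    a covering of the complement of a coordinate axis.

    For a function of z1 = x + i y and t = Re z2 the equation reads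
    u_tt (u_xx + u_yy) - u_xt^2 - u_yt^2 = 16.  LeBrun's description of the
    Taub-NUT metric on C^2, with coordinates (w1, w2), uses two functions
    A, B >= 0 determined by |w1|^2 = A exp (A - B) and |w2|^2 = B exp (B - A);
    its potential is A + B + (A^2 + B^2) / 2, and it is a Ricci-flat, nonflat
    metric with constant determinant.  Substituting w1 = z1 exp (- z2 / 2) and
    w2 = exp (z2 / 2), a map of constant Jacobian, gives a potential on C^2 that
    is invariant under imaginary translations of z2.  Only real quantities
    remain: with B = exp q and A = |z1|^2 exp (- q), both conditions on A and B
    amount to the single equation  q + exp q - |z1|^2 exp (- q) = t,  and
    u = 2 (A + B) + A^2 + B^2, doubled to make the determinant equal to 1.

    The left side of this equation has slope D = 1 + A + B >= 1 in q, so q is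
    globally defined, continuous and differentiable ([is_derive_profile_root]),
    with q_t = 1 / D and q_x = 2 x exp (- q) / D.  Hence the algebra generated by
    x, y, exp q, exp (- q) and 1 / D is closed under partial derivatives, and all
    its members are smooth ([elementary_smooth]).  The implicit equation makes
    the gradient of u simple, u_x = 4 x (1 + exp (- q)) and u_t = 2 (B - A), and
    from there the complex Hessian, its determinant and its positivity are
    algebra ([hessian_entries], [hessian_det_real]).

    The line z1 = 0 is totally geodesic, being fixed by the isometry
    z1 |-> - z1.  On it A = 0, and the induced metric (1 - 1 / D) (dt^2 + ds^2),
    with 1 - 1 / D = B / (1 + B), is conformal with a factor whose logarithm is
    not affine in t.  So it is curved, and the component of the Riemann tensor
    tangent to the line equals B / D^4 > 0 ([riemann_on_axis]). *)

Set Implicit Arguments.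
Unset Strict Implicit.
Unset Printing Implicit Defensive.

Local Open Scope R_scope.

(** * The implicit equation q + exp q - |z1|^2 exp (- q) = t *)

Definition profile (r q : R) : R := q + exp q - r * exp (- q).

(** All three terms of the profile are nondecreasing in q, and the first has
    slope 1: this gives existence, uniqueness and stability of the root at
    once. *)
Lemma profile_slope (r a b : R) :
  0 <= r -> a <= b -> b - a <= profile r b - profile r a.
Proof.
move=> r0 ab; rewrite /profile.
have H1 : exp a <= exp b by case: ab => [/exp_increasing|->]; lra.
have H2 : exp (- b) <= exp (- a).
  case: (Rle_lt_or_eq_dec _ _ ab) => [ab'|->]; last lra.
  by apply/Rlt_le/exp_increasing; lra.
have := Rmult_le_compat_l r _ _ r0 H2; lra.
Qed.

Lemma profile_expanding (r p q : R) :
  0 <= r -> Rabs (q - p) <= Rabs (profile r q - profile r p).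
Proof.
move=> r0.
have mono a b := @profile_slope r a b r0.
case: (Rle_dec p q) => pq.
  have := mono _ _ pq => H.
  by rewrite !Rabs_right; lra.
have := mono q p ltac:(lra) => H.
by rewrite !Rabs_left; lra.
Qed.

Lemma profile_onto (r t : R) : 0 <= r -> { q : R | profile r q = t }.
Proof.
move=> r0.
pose b := Rabs (t - profile r 0).
have b0 : 0 <= b by apply: Rabs_pos.
have cont : Ranalysis1.continuity (profile r).
  move=> q; apply/continuity_pt_filterlim.
  apply: (ex_derive_continuous (profile r)); rewrite /profile; by auto_derive.
have mono a c := @profile_slope r a c r0.
have up := mono 0 b b0.
have lo := mono (- b) 0 ltac:(lra).
have ub : t - profile r 0 <= b by apply: Rle_abs.
have lb : - b <= t - profile r 0.
  have := Rle_abs (- (t - profile r 0)); rewrite Rabs_Ropp -/b; lra.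
have [|q [_ Hq]] := @IVT_gen (profile r) (- b) b t cont; last by exists q.
by rewrite Rmin_left ?Rmax_right; lra.
Qed.

Lemma sqsum_ge0 (x y : R) : 0 <= x * x + y * y.
Proof. by have := Rle_0_sqr x; have := Rle_0_sqr y; rewrite /Rsqr; lra. Qed.

Definition profile_root (x y t : R) : R := proj1_sig (profile_onto t (sqsum_ge0 x y)).

Lemma profile_rootE (x y t : R) : profile (x * x + y * y) (profile_root x y t) = t.
Proof. exact: (proj2_sig (profile_onto t (sqsum_ge0 x y))). Qed.

(** Moving the parameters changes the root by a controlled amount: evaluating
    the new profile at the old root leaves exactly this residue, which vanishes
    with the change of parameters. *)
Lemma profile_root_gap (x y t x' y' t' : R) :
  profile (x' * x' + y' * y') (profile_root x' y' t')
    - profile (x' * x' + y' * y') (profile_root x y t)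
  = t' - t + ((x' * x' + y' * y') - (x * x + y * y)) * exp (- profile_root x y t).
Proof.
have H := profile_rootE x y t; rewrite profile_rootE -[in t' - t]H.
move: (profile_root x y t) => q; by rewrite /profile; ring.
Qed.

Lemma continuous_profile_root (T : UniformSpace) (x y t : T -> R) (w : T) :
  continuous x w -> continuous y w -> continuous t w ->
  continuous (fun v => profile_root (x v) (y v) (t v)) w.
Proof.
move=> cx cy ct.
pose E := exp (- profile_root (x w) (y w) (t w)).
pose N v := t v - t w + ((x v * x v + y v * y v) - (x w * x w + y w * y w)) * E.
have cN : continuous N w.
  apply: (continuous_plus (fun v => t v - t w)
    (fun v => ((x v * x v + y v * y v) - (x w * x w + y w * y w)) * E)).
    by apply: (continuous_minus t (fun=> t w)) => //; apply: continuous_const.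
  apply: (continuous_mult
    (fun v => (x v * x v + y v * y v) - (x w * x w + y w * y w)) (fun=> E));
    last exact: continuous_const.
  apply: (continuous_minus (fun v => x v * x v + y v * y v)
    (fun=> x w * x w + y w * y w)); last exact: continuous_const.
  by apply: (continuous_plus (fun v => x v * x v) (fun v => y v * y v));
    apply: continuous_mult.
apply/filterlim_locally => eps.
have HN : locally w (fun v => ball (N w) eps (N v)).
  exact: (proj1 (filterlim_locally N (N w)) cN eps).
move: HN; apply: filter_imp => v.
rewrite /ball /= /AbsRing_ball /= /abs /minus /plus /opp /=.
have -> : N w = 0 by rewrite /N; ring.
move=> H; apply: Rle_lt_trans H.
apply: Rle_trans (@profile_expanding (x v * x v + y v * y v) _ _ (sqsum_ge0 _ _)) _.
rewrite profile_root_gap -/E; right; congr Rabs; rewrite /N; ring.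
Qed.

(** Including the limit value at 0 makes the quotient continuous there, so that it
    can be composed with increments that may vanish. *)
Definition exp_slope (d : R) : R :=
  if Req_EM_T d 0 then 1 else (exp d - 1) / d.

Lemma exp_slopeE (d : R) : exp d - 1 = d * exp_slope d.
Proof.
rewrite /exp_slope; case: Req_EM_T => d0 /=; last by field.
by rewrite d0 exp_0; ring.
Qed.

Lemma exp_slope_gt0 (d : R) : 0 < exp_slope d.
Proof.
rewrite /exp_slope; case: Req_EM_T => d0 /=; first lra.
have [d1|d1] : d < 0 \/ 0 < d by lra.
  have := exp_increasing _ _ d1; rewrite exp_0 => H.
  have -> : (exp d - 1) / d = (1 - exp d) * / (- d) by field.
  by apply: Rmult_lt_0_compat; [lra | apply: Rinv_0_lt_compat; lra].
have := exp_increasing _ _ d1; rewrite exp_0 => H.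
by apply: Rmult_lt_0_compat; [lra | apply: Rinv_0_lt_compat; lra].
Qed.

Lemma continuous_exp_slope : continuous exp_slope 0.
Proof.
apply/filterlim_locally => eps.
have [d Hd] := derivable_pt_lim_exp_0 eps (cond_pos eps).
exists d => h; rewrite /ball /= /AbsRing_ball /= /abs /minus /plus /opp /= => Hh.
rewrite /exp_slope; case: (Req_EM_T 0 0) => // e0 /=; case: Req_EM_T => h0 /=.
  by rewrite Rplus_opp_r Rabs_R0; apply: cond_pos.
have Hh' : Rabs h < d by move: Hh; rewrite Ropp_0 Rplus_0_r.
by have := Hd h h0 Hh'; rewrite Rplus_0_l exp_0.
Qed.

(** Since f vanishes at the base point, the difference quotient of the product is
    that of f times k, so continuity of k suffices.  This allows an implicit
    function to be differentiated as a quotient whose denominator involves the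
    function itself, of which only continuity is known. *)
Lemma is_derive_vanishing_mul (f k : R -> R) (df : R) :
  f 0 = 0 -> is_derive f 0 df -> continuous k 0 ->
  is_derive (fun h => f h * k h) 0 (df * k 0).
Proof.
move=> f0 /is_derive_Reals Df ck.
apply/is_derive_Reals => eps eps0.
pose phi h := if Req_EM_T h 0 then df else f h / h.
have phiE h : f h = h * phi h.
  by rewrite /phi; case: Req_EM_T => h0 /=; [rewrite h0 f0; ring | field].
have cphi : continuous phi 0.
  apply/filterlim_locally => e.
  have [d Hd] := Df e (cond_pos e).
  exists d => h; rewrite /ball /= /AbsRing_ball /= /abs /minus /plus /opp /= => Hh.
  rewrite /phi; case: (Req_EM_T 0 0) => // e0 /=; case: Req_EM_T => h0 /=.
    by rewrite Rplus_opp_r Rabs_R0; apply: cond_pos.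
  have Hh' : Rabs h < d by move: Hh; rewrite Ropp_0 Rplus_0_r.
  have := Hd h h0 Hh'; by rewrite Rplus_0_l f0 Rminus_0_r.
have cm : continuous (fun h => phi h * k h) 0 by apply: continuous_mult.
have [d Hd] := proj1 (filterlim_locally _ _) cm (mkposreal _ eps0).
exists d => h h0 Hh.
have := Hd h; rewrite /ball /= /AbsRing_ball /= /abs /minus /plus /opp /=.
rewrite {2}/phi; case: (Req_EM_T 0 0) => // e0 /= H.
rewrite Rplus_0_l f0 phiE.
have -> : (h * phi h * k h - 0 * k 0) / h - df * k 0 = phi h * k h + - (df * k 0).
  by field.
by apply: H; rewrite Ropp_0 Rplus_0_r.
Qed.

(** Implicit differentiation along a curve of parameters.  Writing d for the
    increment of the root, [profile_root_gap] factors as d * S = N, where N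
    depends on the parameters only and S is a difference quotient of the
    profile; S is continuous and positive, so d = N / S is differentiable. *)
Lemma is_derive_profile_root (x y t : R -> R) (dx dy dt : R) :
  is_derive x 0 dx -> is_derive y 0 dy -> is_derive t 0 dt ->
  let q := profile_root (x 0) (y 0) (t 0) in
  is_derive (fun h => profile_root (x h) (y h) (t h)) 0
    ((dt + 2 * (x 0 * dx + y 0 * dy) * exp (- q))
       / (1 + (x 0 * x 0 + y 0 * y 0) * exp (- q) + exp q)).
Proof.
move=> Dx Dy Dt q.
pose d h := profile_root (x h) (y h) (t h) - q.
pose N h := t h - t 0
  + ((x h * x h + y h * y h) - (x 0 * x 0 + y 0 * y 0)) * exp (- q).
pose S h := 1 + exp q * exp_slope (d h)
  + (x h * x h + y h * y h) * exp (- q) * exp_slope (- d h).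
have SN h : d h * S h = N h.
  have := profile_root_gap (x 0) (y 0) (t 0) (x h) (y h) (t h); rewrite -/(N h) => <-.
  have -> : profile_root (x h) (y h) (t h) = q + d h by rewrite /d; ring.
  rewrite -/q /S; move: (d h) => e; rewrite /profile Ropp_plus_distr !exp_plus.
  have := exp_slopeE e; have := exp_slopeE (- e).
  move: (exp_slope (- e)) (exp_slope e) => a b Ha Hb.
  have -> : exp e = 1 + e * b by lra.
  have -> : exp (- e) = 1 - e * a by lra.
  ring.
have d0 : d 0 = 0 by rewrite /d /q; ring.
have slope0 : exp_slope 0 = 1 by rewrite /exp_slope; case: Req_EM_T.
have Spos h : 0 < S h.
  have H1 := Rmult_lt_0_compat _ _ (exp_pos q) (exp_slope_gt0 (d h)).
  have H2 := Rmult_le_pos _ _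
    (Rmult_le_pos _ _ (sqsum_ge0 (x h) (y h)) (Rlt_le _ _ (exp_pos (- q))))
    (Rlt_le _ _ (exp_slope_gt0 (- d h))).
  rewrite /S; lra.
have cx : continuous x 0 by apply: ex_derive_continuous; exists dx.
have cy : continuous y 0 by apply: ex_derive_continuous; exists dy.
have ct : continuous t 0 by apply: ex_derive_continuous; exists dt.
have cd : continuous d 0.
  apply: (continuous_minus (fun h => profile_root (x h) (y h) (t h)) (fun=> q));
    [exact: continuous_profile_root | exact: continuous_const].
have cS : continuous S 0.
  apply: (continuous_plus (fun h => 1 + exp q * exp_slope (d h))
    (fun h => (x h * x h + y h * y h) * exp (- q) * exp_slope (- d h))).
    apply: (continuous_plus (fun=> 1) (fun h => exp q * exp_slope (d h)));
      first exact: continuous_const.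
    apply: (continuous_mult (fun=> exp q)); first exact: continuous_const.
    by apply: continuous_comp; rewrite ?d0 //; apply: continuous_exp_slope.
  apply: (continuous_mult (fun h => (x h * x h + y h * y h) * exp (- q))
    (fun h => exp_slope (- d h))).
    apply: (continuous_mult (fun h => x h * x h + y h * y h));
      last exact: continuous_const.
    by apply: (continuous_plus (fun h => x h * x h) (fun h => y h * y h));
      apply: continuous_mult.
  apply: (continuous_comp (fun h => - d h)); first exact: (continuous_opp d).
  by rewrite d0 Ropp_0; apply: continuous_exp_slope.
have cSinv : continuous (fun h => / S h) 0.
  by apply: continuous_Rinv_comp => //; have := Spos 0; lra.
have DN : is_derive N 0 (dt + 2 * (x 0 * dx + y 0 * dy) * exp (- q)).
  have ex : ex_derive (fun h => x h) 0 by exists dx.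
  have ey : ex_derive (fun h => y h) 0 by exists dy.
  have et : ex_derive (fun h => t h) 0 by exists dt.
  rewrite /N; auto_derive; first tauto.
  rewrite (is_derive_unique (fun h => x h) _ _ Dx) (is_derive_unique (fun h => y h) _ _ Dy)
    (is_derive_unique (fun h => t h) _ _ Dt); ring.
have N0 : N 0 = 0 by rewrite /N; ring.
have := is_derive_vanishing_mul N0 DN cSinv.
have -> : / S 0 = / (1 + (x 0 * x 0 + y 0 * y 0) * exp (- q) + exp q).
  by rewrite /S d0 Ropp_0 slope0; congr (/ _); ring.
move=> H.
have {H} := is_derive_plus _ _ _ _ _ H (is_derive_const q 0).
rewrite plus_zero_r; apply: is_derive_ext => h; rewrite /plus /=.
have -> : profile_root (x h) (y h) (t h) = d h + q by rewrite /d; ring.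
congr (_ + _); rewrite -SN; field.
by have := Spos h; lra.
Qed.

(** * Partial derivatives on C^2 *)

Definition has_partial (a : 'I_4) (f g : C2 -> R) : Prop :=
  forall z, is_derive (fun h => f (translate z (frame a) h)) 0 (g z).

Lemma translate0 (z v : C2) : translate z v 0 = z.
Proof.
case: z => [[x y] [s t]]; rewrite /translate /Cplus /Cmult /=.
by congr (_, _, (_, _)); ring.
Qed.

Lemma has_partialE a f g : has_partial a f g -> partial a f = g.
Proof.
by move=> H; apply: functional_extensionality => z; apply: is_derive_unique.
Qed.

Lemma has_partial_ext a f g f' g' :
  has_partial a f g -> (forall z, f z = f' z) -> (forall z, g z = g' z) ->
  has_partial a f' g'.
Proof.
move=> H ef eg z; rewrite -eg; apply: is_derive_ext (H z) => h; exact: ef.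
Qed.

Lemma has_partial_const a (c : R) : has_partial a (fun=> c) (fun=> 0).
Proof. by move=> z; apply: is_derive_const. Qed.

Lemma has_partial_add a f g f' g' :
  has_partial a f f' -> has_partial a g g' ->
  has_partial a (fun z => f z + g z) (fun z => f' z + g' z).
Proof. by move=> Hf Hg z; apply: is_derive_plus. Qed.

Lemma has_partial_mul a f g f' g' :
  has_partial a f f' -> has_partial a g g' ->
  has_partial a (fun z => f z * g z) (fun z => f' z * g z + f z * g' z).
Proof.
move=> Hf Hg z; have := is_derive_mult _ _ _ _ _ (Hf z) (Hg z) Rmult_comm.
by rewrite !translate0.
Qed.

Lemma has_partial_scal a (c : R) f f' :
  has_partial a f f' -> has_partial a (fun z => c * f z) (fun z => c * f' z).
Proof. by move=> Hf z; apply: is_derive_scal. Qed.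

Lemma has_partial_comp a f f' (k k' : R -> R) :
  has_partial a f f' -> (forall z, is_derive k (f z) (k' (f z))) ->
  has_partial a (fun z => k (f z)) (fun z => f' z * k' (f z)).
Proof.
move=> Hf Hk z; apply: is_derive_comp (Hf z); rewrite translate0; exact: Hk.
Qed.

Definition delta (k : nat) (a : 'I_4) : R := if val a == k then 1 else 0.

Lemma translate_frame a z h :
  [/\ Re (translate z (frame a) h).1 = Re z.1 + h * delta 0 a,
      Im (translate z (frame a) h).1 = Im z.1 + h * delta 1 a
    & Re (translate z (frame a) h).2 = Re z.2 + h * delta 2 a].
Proof.
by case: a => [[|[|[|[|//]]]] ?]; rewrite /delta /Re /Im /=; split; ring.
Qed.

Lemma has_partial_x a : has_partial a (fun z => Re z.1) (fun=> delta 0 a).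
Proof.
move=> z; apply: (@is_derive_ext _ _ (fun h => Re z.1 + h * delta 0 a)).
  by move=> h; have [-> _ _] := translate_frame a z h.
by auto_derive; rewrite ?Rmult_1_l.
Qed.

Lemma has_partial_y a : has_partial a (fun z => Im z.1) (fun=> delta 1 a).
Proof.
move=> z; apply: (@is_derive_ext _ _ (fun h => Im z.1 + h * delta 1 a)).
  by move=> h; have [_ -> _] := translate_frame a z h.
by auto_derive; rewrite ?Rmult_1_l.
Qed.

Lemma has_partial_t a : has_partial a (fun z => Re z.2) (fun=> delta 2 a).
Proof.
move=> z; apply: (@is_derive_ext _ _ (fun h => Re z.2 + h * delta 2 a)).
  by move=> h; have [_ _ ->] := translate_frame a z h.
by auto_derive; rewrite ?Rmult_1_l.
Qed.

(** The induction on the order of differentiation needs a whole family, because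
    its step passes from a function to its partial derivatives. *)
Lemma smooth_of_closed_family (S : (C2 -> R) -> Prop) :
  (forall f, S f -> forall z, continuous f z) ->
  (forall f a, S f -> exists2 g, S g & has_partial a f g) ->
  forall f, S f -> smooth f.
Proof.
move=> Sc Sd f Sf n; elim: n f Sf => [|n IH] f Sf /=; split=> //; try exact: Sc.
move=> a; have [g Sg Hg] := Sd f a Sf.
split; first by move=> z; exists (g z); apply: Hg.
by rewrite (has_partialE Hg); apply: IH.
Qed.

(** * The functions A, B and their smoothness *)

(** With w1 = z1 exp (- z2 / 2) and w2 = exp (z2 / 2) as Taub-NUT coordinates,
    [norm1] and [norm2] are the functions A and B solving
    |w1|^2 = A exp (A - B) and |w2|^2 = B exp (B - A); [log_norm] is log B,
    [inv2] is 1 / B and [weight] is 1 / D, the derivative of [log_norm] in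
    Re z2. *)
Definition log_norm (z : C2) : R := profile_root (Re z.1) (Im z.1) (Re z.2).
Definition norm2 (z : C2) : R := exp (log_norm z).
Definition inv2 (z : C2) : R := exp (- log_norm z).
Definition norm1 (z : C2) : R := (Re z.1 * Re z.1 + Im z.1 * Im z.1) * inv2 z.
Definition weight (z : C2) : R := / (1 + norm1 z + norm2 z).

(** Half of the partial derivative of |z1|^2. *)
Definition radial (a : 'I_4) (z : C2) : R :=
  Re z.1 * delta 0 a + Im z.1 * delta 1 a.

Definition dlog_norm (a : 'I_4) (z : C2) : R :=
  (delta 2 a + 2 * radial a z * inv2 z) * weight z.

Lemma inv2_gt0 z : 0 < inv2 z. Proof. exact: exp_pos. Qed.
Lemma norm2_gt0 z : 0 < norm2 z. Proof. exact: exp_pos. Qed.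
Lemma norm1_ge0 z : 0 <= norm1 z.
Proof. by apply: Rmult_le_pos; [apply: sqsum_ge0 | apply/Rlt_le/inv2_gt0]. Qed.
Lemma norm2_inv2 z : norm2 z * inv2 z = 1.
Proof. by rewrite /norm2 /inv2 -exp_plus Rplus_opp_r exp_0. Qed.
Lemma weight_mul z : (1 + norm1 z + norm2 z) * weight z = 1.
Proof.
rewrite /weight; field.
by have := norm1_ge0 z; have := norm2_gt0 z; lra.
Qed.
Lemma weight_gt0 z : 0 < weight z.
Proof.
apply: Rinv_0_lt_compat.
by have := norm1_ge0 z; have := norm2_gt0 z; lra.
Qed.

Lemma has_partial_log_norm a : has_partial a log_norm (dlog_norm a).
Proof.
move=> z.
have := is_derive_profile_root (has_partial_x a z) (has_partial_y a z) (has_partial_t a z).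
by rewrite translate0; apply.
Qed.

Lemma has_partial_norm2 a :
  has_partial a norm2 (fun z => norm2 z * dlog_norm a z).
Proof.
have := has_partial_comp (has_partial_log_norm a) (fun z => is_derive_exp (log_norm z)).
move/has_partial_ext; apply=> z //; exact: Rmult_comm.
Qed.

Lemma has_partial_inv2 a :
  has_partial a inv2 (fun z => - inv2 z * dlog_norm a z).
Proof.
have D z : is_derive (fun q => exp (- q)) (log_norm z) (- exp (- log_norm z)).
  by auto_derive => //; ring.
have := @has_partial_comp a _ _ (fun q => exp (- q)) (fun q => - exp (- q))
  (has_partial_log_norm a) D.
move/has_partial_ext; apply=> z //; exact: Rmult_comm.
Qed.

Lemma has_partial_norm1 a :
  has_partial a norm1 (fun z => 2 * radial a z * inv2 z - norm1 z * dlog_norm a z).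
Proof.
have Hx := has_partial_x a; have Hy := has_partial_y a.
have := has_partial_mul (has_partial_add (has_partial_mul Hx Hx)
  (has_partial_mul Hy Hy)) (has_partial_inv2 a).
move/has_partial_ext; apply=> z //; rewrite /norm1 /radial; ring.
Qed.

Definition dweight a (z : C2) : R :=
  - (weight z * weight z)
    * (2 * radial a z * inv2 z + (norm2 z - norm1 z) * dlog_norm a z).

Lemma has_partial_weight a : has_partial a weight (dweight a).
Proof.
have D z : is_derive Rinv (1 + norm1 z + norm2 z)
             (- (/ (1 + norm1 z + norm2 z) * / (1 + norm1 z + norm2 z))).
  have H : 1 + norm1 z + norm2 z <> 0.
    by have := norm1_ge0 z; have := norm2_gt0 z; lra.
  by auto_derive => //; field.
have := @has_partial_comp a _ _ Rinv (fun s => - (/ s * / s))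
  (has_partial_add (has_partial_add (has_partial_const a 1) (has_partial_norm1 a))
    (has_partial_norm2 a)) D.
move/has_partial_ext; apply=> z //; rewrite /dweight /weight; ring.
Qed.

(** The generators are chosen so that the formulas [dlog_norm] and [dweight] stay
    in the generated algebra: [log_norm] itself never occurs in a derivative, and
    the only denominator is D. *)
Inductive elementary : (C2 -> R) -> Prop :=
| elementary_const c : elementary (fun=> c)
| elementary_x : elementary (fun z => Re z.1)
| elementary_y : elementary (fun z => Im z.1)
| elementary_norm2 : elementary norm2
| elementary_inv2 : elementary inv2
| elementary_weight : elementary weight
| elementary_add f g :
    elementary f -> elementary g -> elementary (fun z => f z + g z)
| elementary_mul f g :
    elementary f -> elementary g -> elementary (fun z => f z * g z).

Lemma elementary_continuous f : elementary f -> forall z, continuous f z.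
Proof.
have cx z : continuous (fun w : C2 => Re w.1) z.
  apply: (continuous_comp fst fst); exact: continuous_fst.
have cy z : continuous (fun w : C2 => Im w.1) z.
  apply: (continuous_comp fst snd); [exact: continuous_fst | exact: continuous_snd].
have ct z : continuous (fun w : C2 => Re w.2) z.
  apply: (continuous_comp snd fst); [exact: continuous_snd | exact: continuous_fst].
have cq z : continuous log_norm z by apply: continuous_profile_root.
have cB z : continuous norm2 z.
  by apply: continuous_comp (cq z) _; apply: continuous_exp.
have cE z : continuous inv2 z.
  apply: (continuous_comp (fun w => - log_norm w) exp); last exact: continuous_exp.
  exact: (continuous_opp log_norm).
elim=> {f} [c|||||| f g _ Hf _ Hg| f g _ Hf _ Hg] z //.
- exact: continuous_const.
- apply: (continuous_comp (fun w => 1 + norm1 w + norm2 w) Rinv); last apply: continuous_Rinv.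
    apply: (continuous_plus (fun w => 1 + norm1 w) norm2) => //.
    apply: (continuous_plus (fun=> 1) norm1); first exact: continuous_const.
    apply: (continuous_mult (fun w : C2 => Re w.1 * Re w.1 + Im w.1 * Im w.1)) => //.
    by apply: (continuous_plus (fun w : C2 => Re w.1 * Re w.1)
      (fun w : C2 => Im w.1 * Im w.1)); apply: continuous_mult.
  by have := norm1_ge0 z; have := norm2_gt0 z; lra.
- exact: (continuous_plus f g).
- exact: (continuous_mult f g).
Qed.

Ltac close_elementary := repeat first
  [ assumption
  | apply: elementary_const | apply: elementary_x | apply: elementary_y
  | apply: elementary_norm2 | apply: elementary_inv2 | apply: elementary_weight
  | apply: elementary_add | apply: elementary_mul ].

Lemma elementary_norm1 : elementary norm1. Proof. rewrite /norm1; close_elementary. Qed.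
Lemma elementary_dlog_norm a : elementary (dlog_norm a).
Proof. rewrite /dlog_norm /radial; close_elementary. Qed.

Lemma elementary_partial f a :
  elementary f -> exists2 g, elementary g & has_partial a f g.
Proof.
have Hq := elementary_dlog_norm a; have H1 := elementary_norm1.
elim=> {f} [c|||||| f g Ef [f' Ef' Hf] Eg [g' Eg' Hg]| f g Ef [f' Ef' Hf] Eg [g' Eg' Hg]].
- by exists (fun=> 0); [close_elementary | apply: has_partial_const].
- by exists (fun=> delta 0 a); [close_elementary | apply: has_partial_x].
- by exists (fun=> delta 1 a); [close_elementary | apply: has_partial_y].
- by exists (fun z => norm2 z * dlog_norm a z); [close_elementary | apply: has_partial_norm2].
- exists (fun z => -1 * inv2 z * dlog_norm a z); first by close_elementary.
  move/has_partial_ext: (has_partial_inv2 a); apply=> z //; ring.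
- exists (fun z => -1 * (weight z * weight z)
    * (2 * radial a z * inv2 z + (norm2 z + -1 * norm1 z) * dlog_norm a z)).
    by rewrite /radial; close_elementary.
  move/has_partial_ext: (has_partial_weight a); apply=> z //.
  rewrite /dweight; ring.
- by exists (fun z => f' z + g' z); [close_elementary | apply: has_partial_add].
- by exists (fun z => f' z * g z + f z * g' z); [close_elementary | apply: has_partial_mul].
Qed.

Lemma elementary_smooth f : elementary f -> smooth f.
Proof.
apply: smooth_of_closed_family; [exact: elementary_continuous|].
by move=> g a; apply: elementary_partial.
Qed.

(** * The potential and its complex Hessian *)

Definition potential (z : C2) : R :=
  2 * (norm1 z + norm2 z) + norm1 z * norm1 z + norm2 z * norm2 z.

Lemma smooth_potential : smooth potential.
Proof.
have H1 := elementary_norm1; apply: elementary_smooth; rewrite /potential; close_elementary.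
Qed.

Definition potential_grad (a : 'I_4) (z : C2) : R :=
  4 * radial a z * (1 + inv2 z) + 2 * delta 2 a * (norm2 z - norm1 z).

Definition potential_hess (a b : 'I_4) (z : C2) : R :=
  4 * (delta 0 a * delta 0 b + delta 1 a * delta 1 b) * (1 + inv2 z)
  - 8 * radial a z * radial b z * inv2 z * inv2 z * weight z
  - 4 * inv2 z * weight z * (radial a z * delta 2 b + delta 2 a * radial b z)
  + 2 * (1 - weight z) * delta 2 a * delta 2 b.

(** Here du = 2 (1 + A) dA + 2 (1 + B) dB; the coefficient of the derivative of
    [log_norm] in it is 2 (B - A) D, and the factor D cancels against
    [weight]. *)
Lemma has_partial_potential a : has_partial a potential (potential_grad a).
Proof.
have H1 := has_partial_norm1 a; have H2 := has_partial_norm2 a.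
have := has_partial_add (has_partial_add
  (has_partial_scal 2 (has_partial_add H1 H2)) (has_partial_mul H1 H1))
  (has_partial_mul H2 H2).
move/has_partial_ext; apply=> z //.
rewrite /potential_grad /dlog_norm.
have W := weight_mul z; have BE := norm2_inv2 z.
transitivity (4 * (1 + norm1 z) * radial a z * inv2 z
  + 2 * (norm2 z - norm1 z) * ((1 + norm1 z + norm2 z) * weight z)
     * (delta 2 a + 2 * radial a z * inv2 z)); first by ring.
rewrite W.
transitivity (4 * radial a z * (inv2 z + norm2 z * inv2 z) + 2 * delta 2 a * (norm2 z - norm1 z));
  first by ring.
by rewrite BE; ring.
Qed.

Lemma has_partial_radial a b :
  has_partial b (radial a) (fun=> delta 0 a * delta 0 b + delta 1 a * delta 1 b).
Proof.
have := has_partial_add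
  (has_partial_mul (has_partial_x b) (has_partial_const b (delta 0 a)))
  (has_partial_mul (has_partial_y b) (has_partial_const b (delta 1 a))).
move/has_partial_ext; apply=> z //; ring.
Qed.

Lemma has_partial_potential_grad a b : has_partial b (potential_grad a) (potential_hess a b).
Proof.
have H1 := has_partial_norm1 b; have H2 := has_partial_norm2 b.
have := has_partial_add
  (has_partial_mul (has_partial_scal 4 (has_partial_radial a b))
    (has_partial_add (has_partial_const b 1) (has_partial_inv2 b)))
  (has_partial_scal (2 * delta 2 a)
    (has_partial_add H2 (has_partial_scal (-1) H1))).
move/has_partial_ext; apply=> z; first by rewrite /potential_grad; ring.
rewrite /potential_hess /dlog_norm.
have W : (norm1 z + norm2 z) * weight z = 1 - weight z.
  by rewrite -(weight_mul z); ring.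
transitivity
  (4 * (delta 0 a * delta 0 b + delta 1 a * delta 1 b) * (1 + inv2 z)
  - 4 * radial a z * inv2 z * (delta 2 b + 2 * radial b z * inv2 z) * weight z
  + 2 * delta 2 a * (((norm1 z + norm2 z) * weight z)
      * (delta 2 b + 2 * radial b z * inv2 z) - 2 * radial b z * inv2 z)); first by ring.
rewrite W; ring.
Qed.

Definition e0 : 'I_4 := @Ordinal 4 0 isT.
Definition e1 : 'I_4 := @Ordinal 4 1 isT.
Definition e2 : 'I_4 := @Ordinal 4 2 isT.
Definition e3 : 'I_4 := @Ordinal 4 3 isT.

Definition re_axis (i : 'I_2) : 'I_4 := if i == ord0 then e0 else e2.
Definition im_axis (i : 'I_2) : 'I_4 := if i == ord0 then e1 else e3.

Lemma frame_re_axis i : frame (re_axis i) = axis i (RtoC 1).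
Proof. by case: i => [[|[|//]] ?]. Qed.
Lemma frame_im_axis i : frame (im_axis i) = axis i Ci.
Proof. by case: i => [[|[|//]] ?]. Qed.

Lemma d_zbar_real u P (i : 'I_2) :
  (forall a, has_partial a u (P a)) ->
  d_zbar i (fun w => RtoC (u w))
    = (fun z => (/ 2 * P (re_axis i) z, / 2 * P (im_axis i) z)).
Proof.
move=> HP; apply: functional_extensionality => z.
rewrite /d_zbar /dir_deriveC -frame_re_axis -frame_im_axis.
have D a : dir_derive (frame a) (fun w => Re (RtoC (u w))) z = P a z.
  by rewrite -(has_partialE (HP a)).
have D0 a : dir_derive (frame a) (fun w => Im (RtoC (u w))) z = 0.
  by rewrite /dir_derive /= Derive_const.
rewrite !D !D0 /Cmult /Cplus /RtoC /Ci /=.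
by congr (_, _); ring.
Qed.

(** The operator d/dz_i d/dzbar_j is a quarter of
    (d/dx_i - i d/dy_i) (d/dx_j + i d/dy_j), and u is real.  The first index of H
    is the variable differentiated first. *)
Lemma complex_hessianE u P H z i j :
  (forall a, has_partial a u (P a)) ->
  (forall a b, has_partial b (P a) (H a b)) ->
  complex_hessian u z i j
  = (/ 4 * (H (re_axis j) (re_axis i) z + H (im_axis j) (im_axis i) z),
     / 4 * (H (im_axis j) (re_axis i) z - H (re_axis j) (im_axis i) z)).
Proof.
move=> HP HH; rewrite /complex_hessian mxE (d_zbar_real j HP).
rewrite /d_z /dir_deriveC -frame_re_axis -frame_im_axis /=.
have D a b : dir_derive (frame b) (fun w => / 2 * P a w) z = / 2 * H a b z.
  exact: (is_derive_unique _ _ _ (has_partial_scal (/ 2) (HH a b) z)).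
rewrite !D /Cmult /Cminus /Cplus /Copp /RtoC /Ci /=.
by congr (_, _); field.
Qed.

Lemma potential_independent : independent_of_coord e3 potential.
Proof.
move=> z h.
have E : log_norm (translate z (frame e3) h) = log_norm z.
  by rewrite /log_norm; have [-> -> ->] := translate_frame e3 z h;
    rewrite /delta /= !Rmult_0_r !Rplus_0_r.
rewrite /potential /norm1 /norm2 /inv2 E.
by have [-> -> _] := translate_frame e3 z h;
    rewrite /delta /= !Rmult_0_r !Rplus_0_r.
Qed.

Definition hermitian_entry (a b p m : R) (i j : 'I_2) : C :=
  if i == ord0 then if j == ord0 then (a, 0) else (p, m)
  else if j == ord0 then (p, - m) else (b, 0).

Definition base_coef (z : C2) : R := 2 * (1 + inv2 z - norm1 z * inv2 z * weight z).

Lemma hessian_entries z i j :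
  complex_hessian potential z i j =
  hermitian_entry (base_coef z) (/ 2 * (1 - weight z)) (- (Re z.1 * inv2 z * weight z))
    (Im z.1 * inv2 z * weight z) i j.
Proof.
rewrite (complex_hessianE _ _ _ has_partial_potential has_partial_potential_grad).
rewrite /hermitian_entry /potential_hess /radial /base_coef /norm1 /re_axis /im_axis.
by case: i => [[|[|//]] ?]; case: j => [[|[|//]] ?]; rewrite /delta /=;
  congr (_, _); field.
Qed.

Lemma base_coefE z : base_coef z = 2 * (2 + norm1 z + norm2 z + inv2 z) * weight z.
Proof.
have W := weight_mul z; have BE := norm2_inv2 z.
rewrite /base_coef.
transitivity (2 * ((1 + inv2 z) * ((1 + norm1 z + norm2 z) * weight z)
   - norm1 z * inv2 z * weight z)); first by rewrite W; ring.
transitivity (2 * (1 + norm1 z + norm2 z + inv2 z + norm2 z * inv2 z) * weight z);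
  first by ring.
rewrite BE; ring.
Qed.

Lemma base_coef_gt0 z : 0 < base_coef z.
Proof.
rewrite base_coefE; apply: Rmult_lt_0_compat (weight_gt0 z).
have := norm1_ge0 z; have := norm2_gt0 z; have := inv2_gt0 z; lra.
Qed.

(** After clearing the factor 1 / D^2, the claim is
    (2 + A + B + 1 / B) (A + B) - A / B = (1 + A + B)^2, where the terms A / B
    cancel and B * (1 / B) = 1 completes the square. *)
Lemma hessian_det_real z :
  base_coef z * (/ 2 * (1 - weight z))
  - (Re z.1 * inv2 z * weight z) * (Re z.1 * inv2 z * weight z)
  - (Im z.1 * inv2 z * weight z) * (Im z.1 * inv2 z * weight z) = 1.
Proof.
have W := weight_mul z; have BE := norm2_inv2 z.
have W1 : (norm1 z + norm2 z) * weight z = 1 - weight z.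
  by rewrite -W; ring.
rewrite base_coefE -W1.
transitivity (((2 + norm1 z + norm2 z + inv2 z) * (norm1 z + norm2 z)
   - norm1 z * inv2 z) * weight z * weight z); first by rewrite /norm1; field.
transitivity (((2 + norm1 z + norm2 z) * (norm1 z + norm2 z) + norm2 z * inv2 z)
  * weight z * weight z); first by ring.
rewrite BE.
transitivity (((1 + norm1 z + norm2 z) * weight z)
  * ((1 + norm1 z + norm2 z) * weight z)); first by ring.
by rewrite W; ring.
Qed.

Lemma hessian_det z : det2 (complex_hessian potential z) = RtoC 1.
Proof.
rewrite /det2 !hessian_entries /hermitian_entry /= /Cminus /Cmult /Cplus /Copp /RtoC /=.
congr (_, _); last by ring.
by rewrite -{2}(hessian_det_real z); ring.
Qed.

(** Completing the square: a times the form is |a v + conj(c) w|^2 plus the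
    determinant times |w|^2, where c = p + i m. *)
Lemma hermitian_positive (M : 'M[C]_2) a b p m :
  (forall i j, M i j = hermitian_entry a b p m i j) ->
  0 < a -> 0 < a * b - p * p - m * m -> positive_definite M.
Proof.
move=> HM a0 D [[v1 v2] [w1 w2]] v0.
rewrite /sesq !big_ord_recl !big_ord0 !HM /hermitian_entry /component /=.
rewrite /Cmult /Cplus /Cconj /RtoC /Re /Im /=; split; first by ring.
set N := (X in 0 < X).
(* The two squares are the real and imaginary parts of a v + conj(c) w. *)
have aN : a * N = (a * v1 + p * w1 + m * w2) ^ 2 + (a * v2 - m * w1 + p * w2) ^ 2
   + (a * b - p * p - m * m) * (w1 ^ 2 + w2 ^ 2) by rewrite /N; ring.
apply: (Rmult_lt_reg_l a) => //; rewrite Rmult_0_r aN.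
have S1 := pow2_ge_0 (a * v1 + p * w1 + m * w2).
have S2 := pow2_ge_0 (a * v2 - m * w1 + p * w2).
have [w0|w0] : 0 < w1 ^ 2 + w2 ^ 2 \/ w1 ^ 2 + w2 ^ 2 = 0.
- have := pow2_ge_0 w1; have := pow2_ge_0 w2; lra.
- by have := Rmult_lt_0_compat _ _ D w0; lra.
- have sq0 r s : r ^ 2 + s ^ 2 = 0 -> r = 0.
    move=> H; have := pow2_ge_0 r; have := pow2_ge_0 s => ? ?.
    by apply: Rsqr_0_uniq; rewrite Rsqr_pow2; lra.
  have w10 := sq0 _ _ w0; have w20 : w2 = 0 by apply: (sq0 w2 w1); lra.
  rewrite w10 w20 in v0 *.
  have [|H] : 0 < v1 ^ 2 + v2 ^ 2 \/ v1 ^ 2 + v2 ^ 2 = 0.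
  + have := pow2_ge_0 v1; have := pow2_ge_0 v2; lra.
  + move=> H; have := Rmult_lt_0_compat _ _ (Rmult_lt_0_compat _ _ a0 a0) H; lra.
  + case: v0; have v10 := sq0 _ _ H.
    by have -> : v2 = 0; [apply: (sq0 v2 v1); lra | rewrite v10].
Qed.

Lemma hessian_positive z : positive_definite (complex_hessian potential z).
Proof.
apply: hermitian_positive (hessian_entries z) (base_coef_gt0 z) _.
have := hessian_det_real z; lra.
Qed.

(** * Curvature along the line z1 = 0 *)

Definition metric := riemannian_metric (complex_hessian potential).

Definition metric_coef (a b : 'I_4) (z : C2) : R :=
  let p := - (2 * Re z.1 * inv2 z * weight z) in
  let m := 2 * Im z.1 * inv2 z * weight z in
  match val a, val b with
  | 0%N, 0%N | 1%N, 1%N => 2 * base_coef z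
  | 0%N, 2%N | 2%N, 0%N | 1%N, 3%N | 3%N, 1%N => p
  | 0%N, 3%N | 3%N, 0%N => m
  | 1%N, 2%N | 2%N, 1%N => - m
  | 2%N, 2%N | 3%N, 3%N => 1 - weight z
  | _, _ => 0
  end.

Lemma metricE z a b : metric z a b = metric_coef a b z.
Proof.
rewrite /metric /riemannian_metric mxE /sesq !big_ord_recl !big_ord0 !hessian_entries.
rewrite /hermitian_entry /component /metric_coef.
by case: a => [[|[|[|[|//]]]] ?]; case: b => [[|[|[|[|//]]]] ?];
  rewrite /= /Cmult /Cplus /Cconj /RtoC /Re /Im /=; field.
Qed.

Definition on_axis (z : C2) : Prop := z.1 = RtoC 0.

Lemma on_axis_translate z (a : 'I_4) h :
  (2 <= a)%N -> on_axis z -> on_axis (translate z (frame a) h).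
Proof.
case: a => [[|[|[|[|//]]]] ?] // _; rewrite /on_axis /translate /= => ->;
  rewrite /Cplus /Cmult /RtoC /=; congr (_, _); ring.
Qed.

(** Only the two directions of z2 are tangent to the line, and for these a
    function may be replaced by any other one with the same restriction.  In
    this way Christoffel symbols need to be known on the line only. *)
Lemma partial_on_axis (a : 'I_4) f g z :
  (2 <= a)%N -> on_axis z -> (forall w, on_axis w -> f w = g w) ->
  partial a f z = partial a g z.
Proof.
move=> a2 z0 fg; apply: Derive_ext => h; apply: fg; exact: on_axis_translate.
Qed.

Lemma partial_const a (c : R) z : partial a (fun=> c) z = 0.
Proof. by rewrite (has_partialE (has_partial_const a c)). Qed.

Lemma partial_metric a b c z :
  partial a (fun w => metric w b c) z = partial a (metric_coef b c) z.
Proof. by apply: Derive_ext => h; rewrite metricE. Qed.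

Lemma fibre_coef_gt0 z : 0 < 1 - weight z.
Proof.
rewrite -(weight_mul z).
have -> : (1 + norm1 z + norm2 z) * weight z - weight z
  = (norm1 z + norm2 z) * weight z by ring.
apply: Rmult_lt_0_compat (weight_gt0 z).
have := norm1_ge0 z; have := norm2_gt0 z; lra.
Qed.

Lemma metric_on_axis z :
  on_axis z ->
  metric z = diag_mx (\row_j (if (j < 2)%N then 2 * base_coef z else 1 - weight z)).
Proof.
move=> z0; apply/matrixP => i j; rewrite metricE !mxE /metric_coef z0 /RtoC /=.
case: i => [[|[|[|[|//]]]] ?]; case: j => [[|[|[|[|//]]]] ?];
  rewrite /= ?GRing.mulr1n ?GRing.mulr0n //; rewrite /GRing.zero /=; ring.
Qed.

Lemma invmx_diag (F : fieldType) n (d : 'rV[F]_n) :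
  (forall j, d ord0 j != 0%R) ->
  invmx (diag_mx d) = diag_mx (\row_j (d ord0 j)^-1%R).
Proof.
move=> d0.
have H : (diag_mx d *m diag_mx (\row_j (d ord0 j)^-1%R) = 1%:M)%R.
  rewrite mulmx_diag -diag_const_mx; congr diag_mx.
  by apply/rowP => j; rewrite !mxE GRing.mulfV.
have [U _] := mulmx1_unit H.
by rewrite -[RHS](mulKmx U) H mulmx1.
Qed.

Lemma invmx_metric_on_axis z (k m : 'I_4) :
  on_axis z -> (2 <= k)%N ->
  invmx (metric z) k m = if m == k then / (1 - weight z) else 0.
Proof.
move=> z0 k2; have base0 : 2 * base_coef z <> 0 by have := base_coef_gt0 z; lra.
have fibre0 : 1 - weight z <> 0 by have := fibre_coef_gt0 z; lra.
rewrite (metric_on_axis z0) invmx_diag; last first.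
  by move=> j; rewrite mxE; case: ifP => _; apply/eqP.
rewrite !mxE ltnNge k2 /= eq_sym; by case: eqP.
Qed.

Lemma big_ord4 (F : 'I_4 -> R) :
  \big[Rplus/0]_(m < 4) F m = F e0 + (F e1 + (F e2 + F e3)).
Proof.
rewrite !big_ord_recl big_ord0 Rplus_0_r.
by congr (F _ + (F _ + (F _ + F _))); apply: val_inj.
Qed.

(** On the line the metric is diagonal, so raising the index k involves a single
    entry of the inverse. *)
Lemma christoffel_on_axis z (k i j : 'I_4) :
  on_axis z -> (2 <= k)%N ->
  christoffel metric k i j z =
  / 2 * (/ (1 - weight z) * (partial i (metric_coef j k) z
    + partial j (metric_coef i k) z - partial k (metric_coef i j) z)).
Proof.
move=> z0 k2; rewrite /christoffel big_ord4 !invmx_metric_on_axis // !partial_metric.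
by case: k k2 => [[|[|[|[|//]]]] ?] // _; rewrite /= ?Rmult_0_l ?Rplus_0_l ?Rplus_0_r;
 do ?[congr (_ * (_ * (_ + _ - _)))]; congr partial; congr metric_coef; apply: val_inj.
Qed.

Lemma partial_fibre_coef a (i : 'I_4) z :
  on_axis z -> (2 <= i)%N ->
  partial a (metric_coef i i) z =
    delta 2 a * (norm2 z * weight z * weight z * weight z).
Proof.
move=> z0 i2.
have -> : partial a (metric_coef i i) z = - dweight a z.
  have H : has_partial a (metric_coef i i) (fun z => - dweight a z).
    have := has_partial_add (has_partial_const a 1)
      (has_partial_scal (-1) (has_partial_weight a)).
    move/has_partial_ext; apply=> w; last by ring.
    by case: i i2 => [[|[|[|[|//]]]] ?] // _; rewrite /metric_coef /=; ring.
  by rewrite (has_partialE H).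
rewrite /dweight /dlog_norm /radial /norm1 z0 /RtoC /=; ring.
Qed.

Lemma partial_offdiag_fibre a z :
  partial a (metric_coef e2 e3) z = 0 /\ partial a (metric_coef e3 e2) z = 0.
Proof. by split; exact: partial_const. Qed.

Lemma partial_mixed (a i j : 'I_4) z :
  on_axis z -> (2 <= a)%N -> (i < 2)%N -> (2 <= j)%N ->
  partial a (metric_coef i j) z = 0 /\ partial a (metric_coef j i) z = 0.
Proof.
move=> z0 a2 i2 j2.
split; rewrite -[RHS](partial_const a 0 z); apply: partial_on_axis => // w w0;
 by case: i i2 => [[|[|[|[|//]]]] ?] // _; case: j j2 => [[|[|[|[|//]]]] ?] // _;
   rewrite /metric_coef w0 /RtoC /=; ring.
Qed.

(** The line is totally geodesic, by the symmetry z1 |-> - z1; in coordinates, the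
    mixed entries of the metric vanish along it and the tangential ones have zero
    normal derivative there. *)
Lemma christoffel_fibre_base z (i : 'I_4) (m : 'I_4) :
  on_axis z -> (2 <= i)%N -> (m < 2)%N -> christoffel metric e2 i m z = 0.
Proof.
move=> z0 i2 m2; rewrite christoffel_on_axis //.
have [-> _] := partial_mixed z0 i2 m2 (isT : (2 <= e2)%N).
have [_ ->] := partial_mixed z0 (isT : (2 <= e2)%N) m2 i2.
have -> : partial m (metric_coef i e2) z = 0.
  have [->|ni] : i = e2 \/ i <> e2 by case: (i =P e2); [left | right].
    rewrite partial_fibre_coef //.
    by case: m m2 => [[|[|[|[|//]]]] ?] // _; rewrite /delta /=; ring.
  have -> : i = e3.
    by case: i i2 ni => [[|[|[|[|//]]]] ?] // _ ni; [case: ni|]; apply: val_inj.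
  exact: partial_const.
by ring.
Qed.

(** These are the symbols of the conformal metric G (dt^2 + ds^2) with
    G = B / D, D = 1 + B, for which G_t / (2 G) = 1 / (2 D^2). *)
Lemma christoffel_fibre z :
  on_axis z ->
  [/\ christoffel metric e2 e2 e2 z = / 2 * (weight z * weight z),
      christoffel metric e2 e3 e3 z = - / 2 * (weight z * weight z),
      christoffel metric e3 e2 e3 z = / 2 * (weight z * weight z),
      christoffel metric e2 e2 e3 z = 0
    & christoffel metric e2 e3 e2 z = 0].
Proof.
move=> z0.
have W1 : 1 - weight z = norm2 z * weight z.
  by rewrite -{1}(weight_mul z) /norm1 z0 /RtoC /=; ring.
have W0 := weight_gt0 z; have B0 := norm2_gt0 z.
have [P23 P32] := partial_offdiag_fibre e2 z.
have [Q23 Q32] := partial_offdiag_fibre e3 z.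
split; rewrite christoffel_on_axis // ?P23 ?P32 ?Q23 ?Q32 ?partial_fibre_coef //
  W1 /delta /=; field; lra.
Qed.

(** The quadratic terms cancel, as for any conformal metric with factor depending
    on t alone; what remains is the t-derivative of - 1 / (2 D^2), and
    D_t = B / D. *)
Lemma riemann_on_axis z :
  on_axis z ->
  riemann_tensor metric e2 e3 e2 e3 z = norm2 z * weight z ^ 4.
Proof.
move=> z0; rewrite /riemann_tensor big_ord4.
have [C222 C233 C323 C223 C232] := christoffel_fibre z0.
rewrite (@christoffel_fibre_base z e2 e0) // (@christoffel_fibre_base z e2 e1) //.
rewrite (@christoffel_fibre_base z e3 e0) // (@christoffel_fibre_base z e3 e1) //.
rewrite C222 C233 C323 C223 C232.
have -> : partial e2 (christoffel metric e2 e3 e3) z = norm2 z * weight z ^ 4.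
  rewrite (@partial_on_axis e2 _ (fun w => - / 2 * (weight w * weight w)) z isT z0);
    last by move=> w w0; have [_ -> _ _ _] := christoffel_fibre w0.
  rewrite (has_partialE (has_partial_scal _ (has_partial_mul
    (has_partial_weight e2) (has_partial_weight e2)))).
  by rewrite /dweight /dlog_norm /radial /norm1 /delta z0 /RtoC /=; field.
have -> : partial e3 (christoffel metric e2 e2 e3) z = 0.
  transitivity (partial e3 (fun=> 0) z); last exact: partial_const.
  apply: (@partial_on_axis e3 _ (fun=> 0) z isT z0) => w w0.
  by have [_ _ _ ->] := christoffel_fibre w0.
by ring.
Qed.

Theorem corollary3 :
  exists u : C2 -> R,
    smooth u /\
    (exists a : 'I_4, independent_of_coord a u) /\
    (forall z : C2, det2 (complex_hessian u z) = RtoC 1) /\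
    (forall z : C2, positive_definite (complex_hessian u z)) /\
    ~ flat_kahler (complex_hessian u).
Proof.
exists potential; split; first exact: smooth_potential.
split; first by exists e3; apply: potential_independent.
split; first exact: hessian_det.
split; first exact: hessian_positive.
pose o : C2 := (RtoC 0, RtoC 0).
move=> /(_ o e2 e3 e2 e3); rewrite -/metric riemann_on_axis //.
have := Rmult_lt_0_compat _ _ (norm2_gt0 o) (pow_lt _ 4 (weight_gt0 o)); lra.
Qed.
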